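(* Let $k$ be a field of characteristic $0$, and let $A$ be an inverse limit (over an inversely directed partially ordered set) of finite-dimensional solvable Lie algebras $A_i$ over $k$. Then any finite-dimensional homomorphic image $B$ of $A$ is solvable.
   Context: A homomorphic image of $A$ means the codomain $B$ of a surjective homomorphism of Lie algebras $A\to B$ (an abstract homomorphism; no continuity is assumed). The derived series of a Lie algebra $A$ is $A^{(0)}=A$, $A^{(n+1)}=[A^{(n)},A^{(n)}]$ (the span of the brackets); $A$ is solvable if $A^{(n)}=\{0\}$ for some $n\ge 0$. No surjectivity of the connecting maps or projection maps of the inverse system is assumed. *)

(* Defs.v *)
From HB Require Import structures.
From mathcomp Require Import all_boot all_order all_algebra.

Set Implicit Arguments.
Unset Strict Implicit.
Unset Printing Implicit Defensive.

Import Order.TTheory GRing.Theory.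
Local Open Scope ring_scope.

HB.mixin Record Lmodule_isLieAlgebra (k : fieldType) L of GRing.Lmodule k L := {
  lie : L -> L -> L;
  lie_linearl : forall y : L, linear (lie^~ y);
  lie_linearr : forall x : L, linear (lie x);
  lie_alternating : forall x : L, lie x x = 0;
  lie_jacobi : forall x y z : L,
    lie x (lie y z) + lie y (lie z x) + lie z (lie x y) = 0
}.

#[short(type="lieAlgType")]
HB.structure Definition LieAlgebra (k : fieldType) :=
  { L of Lmodule_isLieAlgebra k L & GRing.Lmodule k L }.

#[short(type="fdLieAlgType")]
HB.structure Definition FDLieAlgebra (k : fieldType) :=
  { L of LieAlgebra k L & Vector k L }.

Definition lie_morphism (k : fieldType) (L M : lieAlgType k)
    (f : {linear L -> M}) : Prop :=
  {morph f : x y / lie x y >-> lie x y}.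

Definition in_span (k : fieldType) (V : lmodType k) (S : V -> Prop) (x : V) :
    Prop :=
  exists s : seq (k * V),
    (forall p, p \in s -> S p.2) /\ x = \sum_(p <- s) p.1 *: p.2.

Fixpoint derived_series (k : fieldType) (L : lieAlgType k) (n : nat) :
    L -> Prop :=
  if n is n'.+1 then
    in_span (fun z => exists x y : L,
      [/\ derived_series n' x, derived_series n' y & z = lie x y])
  else fun=> True.

Definition lie_solvable (k : fieldType) (L : lieAlgType k) : Prop :=
  exists n : nat, forall x : L, derived_series n x -> x = 0.

Definition inversely_directed (d : Order.disp_t) (I : porderType d) : Prop :=
  forall i j : I, exists l : I, (l <= i)%O /\ (l <= j)%O.

(* The index poset is directed downwards, so the connecting map attached to
   i <= j goes from L i to L j. *)
Definition is_inverse_system (k : fieldType) (d : Order.disp_t)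
    (I : porderType d) (L : I -> lieAlgType k)
    (phi : forall i j : I, (i <= j)%O -> {linear L i -> L j}) : Prop :=
  [/\ forall (i j : I) (ij : (i <= j)%O), lie_morphism (phi i j ij),
      forall (i : I) (ii : (i <= i)%O) (x : L i), phi i i ii x = x
    & forall (i j l : I) (ij : (i <= j)%O) (jl : (j <= l)%O) (il : (i <= l)%O)
        (x : L i), phi j l jl (phi i j ij x) = phi i l il x].

Definition compatible_family (k : fieldType) (d : Order.disp_t)
    (I : porderType d) (L : I -> lieAlgType k)
    (phi : forall i j : I, (i <= j)%O -> {linear L i -> L j})
    (x : forall i : I, L i) : Prop :=
  forall (i j : I) (ij : (i <= j)%O), phi i j ij (x i) = x j.

(* a |-> (pi i a)_i is an isomorphism of A onto the Lie subalgebra of compatible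
   families in the product of the L i, with componentwise operations.  Equality
   of families is pointwise, so no extensionality axiom is needed. *)
Definition is_inverse_limit (k : fieldType) (d : Order.disp_t)
    (I : porderType d) (L : I -> lieAlgType k)
    (phi : forall i j : I, (i <= j)%O -> {linear L i -> L j})
    (A : lieAlgType k) (pi : forall i : I, {linear A -> L i}) : Prop :=
  [/\ forall i : I, lie_morphism (pi i),
      forall a : A, compatible_family phi (fun i => pi i a),
      forall a b : A, (forall i : I, pi i a = pi i b) -> a = b
    & forall x : (forall i : I, L i), compatible_family phi x ->
        exists a : A, forall i : I, pi i a = x i].

(* Main.v *)
(* If [x] lies in [[A, A]], then each [pi i x] lies in [[L i, L i]], so
   [ad (pi i x)] is nilpotent because [L i] is solvable and [k] has
   characteristic [0].  Hence [q(ad (pi i x))] is bijective on [L i] for every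
   polynomial [q] with [q(0) <> 0]; the inverses are compatible, so [q(ad x)] is
   surjective on [A], and [q(ad (f x))] on [B].  Writing the characteristic
   polynomial of [ad (f x)] as [X^m q] with [q(0) <> 0] gives
   [ad (f x) ^ m = 0].  So [[B, B]] consists of ad-nilpotent elements, and [B]
   is solvable by Engel's theorem.

   The nilpotency of [ad x] for [x] in [[L, L]], [L] solvable, is obtained over
   an arbitrary field of characteristic [0] from traces: a matrix whose positive
   powers all have trace [0] is nilpotent.  One climbs the derived series from
   its zero term; once an ideal consists of ad-nilpotent elements, Engel's
   theorem puts it in the radical of the trace form on the associative algebra
   generated by [ad L]. *)
Require Import Defs.
From HB Require Import structures.
From mathcomp Require Import all_boot all_order all_algebra.

Set Implicit Arguments.
Unset Strict Implicit.
Unset Printing Implicit Defensive.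

Import Order.TTheory GRing.Theory.
Local Open Scope ring_scope.

(** * Nilpotent matrices and traces *)

Section NilpotentMatrices.
Variable k : fieldType.

(** Induction on the size through a rank factorization [A = C R]: [R C] has the same trace, is
    smaller when [A] is singular, and is nilpotent because [(R C)^(i+1) = R A^i C]. *)
Lemma mxtrace_nilpotent n (A : 'M[k]_n) m : A ^+ m = 0 -> \tr A = 0.
Proof.
elim/ltn_ind: n => n IHn in A m *; move=> Am0.
have [rAn|rAn] := ltnP (\rank A) n; last first.
  case: n => [|n] in A Am0 rAn {IHn} *; first by rewrite /mxtrace big_ord0.
  have uA : A \is a GRing.unit.
    by rewrite -[_ \is a _]row_free_unit /row_free eqn_leq rank_leq_row.
  by have := unitrX m uA; rewrite Am0 unitr0.
move: (col_base A) (row_base A) (mulmx_base A) => C R CR.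
rewrite -CR mxtrace_mulC.
apply: (IHn _ rAn _ m.+1).
suff -> i : (R *m C) ^+ i.+1 = R *m A ^+ i *m C by rewrite Am0 mulmx0 mul0mx.
elim: i => [|i IHi]; first by rewrite expr0 mulmx1.
by rewrite exprS IHi [A ^+ i.+1]exprS -!mulmxE !mulmxA -(mulmxA R C R) CR.
Qed.

Lemma mxtrace_idempotent n (A : 'M[k]_n) : A *m A = A -> \tr A = (\rank A)%:R.
Proof.
move=> AA; rewrite -{1}(mulmx_base A) mxtrace_mulC.
have := mulmx_base A.
move: (col_base A) (row_base A) (col_base_full A) (row_base_free A).
move=> C R fullC freeR CR.
suff -> : R *m C = 1%:M by rewrite mxtrace1.
apply: (row_full_inj fullC); apply: (row_free_inj freeR).
by rewrite mulmx1 -!mulmxA CR !mulmxA CR AA.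
Qed.

Lemma poly_split0 (p : {poly k}) : p != 0 ->
  exists m, exists2 q : {poly k}, q.[0] != 0 & p = 'X^m * q.
Proof.
move=> p0; have [m [q]] := multiplicity_XsubC p 0; rewrite p0 /= => q0 ->.
by exists m; exists q; rewrite ?subr0 1?mulrC.
Qed.

(* If [X^m q] kills [A] with [q(0) <> 0], then [q] is [c (1 - u)] with [X | u],
   and [u^m(A)] is an idempotent without constant term that fixes [A^m]. *)
Lemma nilpotent_of_traces n (A : 'M[k]_n) :
  [pchar k] =i pred0 -> (forall i, \tr (A ^+ i.+1) = 0) ->
  exists m, A ^+ m = 0.
Proof.
move=> char0 trA; case: n => [|n] in A trA *.
  by exists 0%N; rewrite [LHS]flatmx0 [RHS]flatmx0.
have cA0 : char_poly A != 0 by rewrite monic_neq0 ?char_poly_monic.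
have [m [q q0 eq_cA]] := poly_split0 cA0.
pose v := 1 - q.[0]^-1 *: q.
have /factor_theorem[w ew] : root v 0.
  by rewrite /root /v !hornerE mulVf // subrr.
rewrite subr0 in ew.
(* The exponent is [m.+1] rather than [m] so that [e = v^(m+1)] is divisible by [X] even when
   [m = 0]. *)
have kill : 'X^(m.+1) * (1 - v) = (q.[0]^-1 *: 'X) * char_poly A.
  rewrite eq_cA /v opprB addrC subrK exprS -scalerAr -scalerAl; congr (_ *: _).
  by rewrite mulrA.
have killA : horner_mx A ('X^(m.+1) * (1 - v)) = 0.
  by rewrite kill rmorphM /= Cayley_Hamilton mulr0.
pose e := v ^+ m.+1.
have geo : 1 - v ^+ m.+1 = (1 - v) * \sum_(i < m.+1) v ^+ i.
  by rewrite -opprB subrX1 -mulNr opprB.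
have [s es] : exists s, e * e = e + s * ('X^(m.+1) * (1 - v)).
  exists (- (w ^+ m.+1 * \sum_(i < m.+1) v ^+ i)).
  have -> : e * e = e - v ^+ m.+1 * (1 - v ^+ m.+1).
    by rewrite mulrBr mulr1 opprB addrC subrK.
  congr (_ + _); rewrite mulNr; congr (- _).
  rewrite geo {1}ew exprMn.
  by rewrite -!mulrA; congr (_ * _); rewrite mulrA mulrC.
have tr0 p : \tr (horner_mx A (p * 'X)) = 0.
  rewrite -[p]coefK poly_def mulr_suml rmorph_sum raddf_sum big1 // => i _ /=.
  rewrite -scalerAl -exprSr horner_mxZ rmorphXn /= horner_mx_X.
  by rewrite mxtraceZ trA mulr0.
set E := horner_mx A e.
have EE : E *m E = E.
  by rewrite mulmxE -rmorphM es rmorphD rmorphM /= killA mulr0 addr0.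
(* The rank of an idempotent is its trace in characteristic 0, and the trace of [E] vanishes since
   [X] divides [e]. *)
have rE : \rank E = 0%N.
  apply/eqP; rewrite -((pcharf0P k).1 char0) -mxtrace_idempotent //.
  by rewrite /E /e exprSr {2}ew mulrA tr0.
have E0 : E = 0 by apply/eqP; rewrite -mxrank_eq0 rE.
exists m.+1.
have -> : A ^+ m.+1 = horner_mx A 'X^(m.+1) by rewrite rmorphXn /= horner_mx_X.
have [s' es'] : exists s',
    'X^(m.+1) = 'X^(m.+1) * e + s' * ('X^(m.+1) * (1 - v)).
  exists (\sum_(i < m.+1) v ^+ i).
  rewrite mulrA [_ * 'X^_]mulrC -mulrA [_ * (1 - v)]mulrC -geo.
  by rewrite -mulrDr addrC subrK mulr1.
rewrite es' rmorphD [X in X + _]rmorphM [X in _ + X]rmorphM /=.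
by rewrite -/E E0 killA !mulr0 addr0.
Qed.
End NilpotentMatrices.

(** * Lie algebra identities, ideals and Engel's theorem *)

Section LieBasics.
Variables (k : fieldType) (L : lieAlgType k).
Implicit Types x y z : L.

HB.instance Definition _ (x : L) :=
  GRing.isLinear.Build k L L *:%R (lie x) (lie_linearr x).

Lemma lieDl x y z : lie (x + y) z = lie x z + lie y z.
Proof. by have := lie_linearl z 1 x y; rewrite !scale1r. Qed.

Lemma lie0l y : lie 0 y = 0.
Proof. by apply: (addrI (lie 0 y)); rewrite -lieDl !addr0. Qed.

Lemma lieZl a x y : lie (a *: x) y = a *: lie x y.
Proof. by have := lie_linearl y a x 0; rewrite /= !addr0 lie0l addr0. Qed.

Lemma lieC x y : lie x y = - lie y x.
Proof.
apply/eqP; rewrite -addr_eq0; have := lie_alternating (x + y).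
by rewrite lieDl !raddfD /= !lie_alternating add0r addr0 => ->.
Qed.

Lemma lieA x y z : lie x (lie y z) = lie (lie x y) z + lie y (lie x z).
Proof.
apply/eqP; rewrite -subr_eq0 opprD addrA -(lie_jacobi x y z).
rewrite (lieC z (lie x y)) (lieC z x) raddfN /=.
by rewrite addrAC.
Qed.

Definition ad_nilpotent x := exists n, forall y, iter n (lie x) y = 0.

End LieBasics.

Section Subspaces.
Variables (k : fieldType) (L : fdLieAlgType k).
Implicit Types (x y z : L) (U V W S : {vspace L}).

Lemma dim_addv_line W v : v \notin W -> \dim (W + <[v]>) = (\dim W).+1.
Proof.
move=> vW; rewrite dimv_disjoint_sum ?dim_vline.
  by case: eqP vW => [->|_ _]; rewrite ?mem0v // addn1.
apply/eqP; rewrite -subv0; apply/subvP => x /memv_capP[xW /vlineP[a xa]].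
move: xW; rewrite xa; have [->|a0] := eqVneq a 0.
  by rewrite scale0r !mem0v.
move=> avW; case/negP: vW; have := memvZ a^-1 avW.
by rewrite scalerA mulVf ?scale1r.
Qed.

Definition lieprod U V : {vspace L} :=
  <<[seq lie x y | x <- vbasis U, y <- vbasis V]>>%VS.

Lemma memv_lieprod U V x y : x \in U -> y \in V -> lie x y \in lieprod U V.
Proof.
move=> /coord_vbasis-> /coord_vbasis->.
rewrite raddf_sum /= memv_suml // => j _; rewrite linearZ /= memvZ //.
rewrite (big_morph (fun x => lie x (vbasis V)`_j) (id1 := 0) (op1 := +%R)).
- rewrite memv_suml // => i _; rewrite lieZl memvZ // memv_span //.
  by apply/allpairs_f; apply: mem_nth; rewrite size_tuple.
- by move=> a b; rewrite lieDl.
- by rewrite lie0l.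
Qed.

Lemma lieprod_ind U V (P : L -> Prop) :
  P 0 -> (forall a x y, P x -> P y -> P (a *: x + y)) ->
  (forall x y, x \in U -> y \in V -> P (lie x y)) ->
  forall z, z \in lieprod U V -> P z.
Proof.
move=> P0 Plin Plie z; rewrite /lieprod.
set X := (X in span X) => /(@coord_span _ _ _ (in_tuple X)) ->.
elim/big_rec: _ => //= i y _ Py; apply: Plin => //.
have /allpairsP[[a b] /= [aU bV ->]] : X`_i \in X by apply: mem_nth.
by apply: Plie; apply: vbasis_mem.
Qed.

Lemma lieprod_subP U V W :
  (forall x y, x \in U -> y \in V -> lie x y \in W) -> (lieprod U V <= W)%VS.
Proof.
move=> H; apply/subvP; apply: lieprod_ind => //; first exact: mem0v.
by move=> a x y xW yW; rewrite rpredD // memvZ.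
Qed.

(** [lie_stable fullv W] makes [W] an ideal, and [lie_stable S S] makes [S] a subalgebra. *)
Definition lie_stable S W := forall x y, x \in S -> y \in W -> lie x y \in W.

Fixpoint derv n : {vspace L} :=
  if n is n'.+1 then lieprod (derv n') (derv n') else fullv.

Lemma memv_derv n x : derived_series n x <-> x \in derv n.
Proof.
elim: n x => [|n IHn] x /=; first by rewrite memvf.
split.
  case=> s [sP ->]; rewrite big_seq rpred_sum // => p.
  case/sP=> [a [b [/IHn a1 /IHn b1 ->]]].
  by rewrite memvZ // memv_lieprod.
move: x; apply: lieprod_ind => [|c x y [s [sP ->]] [t [tP ->]]|x y xn yn].
- by exists [::]; split=> [//|]; rewrite big_nil.
- exists ([seq (c * p.1, p.2) | p <- s] ++ t); split=> [p|].
    by rewrite mem_cat => /orP[/mapP[q /sP ? ->]|/tP].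
  rewrite big_cat big_map /= scaler_sumr; congr (_ + _).
  by apply: eq_bigr => p _; rewrite scalerA.
- exists [:: (1, lie x y)]; split=> [p|]; last by rewrite big_seq1 scale1r.
  by rewrite inE => /eqP -> /=; exists x, y; split=> //; apply/IHn.
Qed.

Lemma solvable_derv : lie_solvable L <-> exists n, derv n = 0%VS.
Proof.
split=> -[n Dn]; exists n.
  by apply/eqP; rewrite -subv0; apply/subvP => x /memv_derv/Dn ->; exact: mem0v.
by move=> x /memv_derv; rewrite Dn memv0 => /eqP.
Qed.

Lemma derv_ideal n : lie_stable fullv (derv n).
Proof.
elim: n => [|n IHn] z x zL; first by rewrite !memvf.
move: x; apply: lieprod_ind => [|a x y xW yW|x y xW yW].
- by rewrite raddf0 mem0v.
- by rewrite raddfD /= linearZ /= rpredD // memvZ.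
- by rewrite lieA rpredD ?memv_lieprod ?IHn.
Qed.

Lemma derv_sub n m : (derv (n + m) <= derv n)%VS.
Proof.
elim: m => [|m IHm]; first by rewrite addn0.
apply: subv_trans IHm; rewrite addnS; apply: lieprod_subP => x y _.
by apply: derv_ideal; rewrite memvf.
Qed.

(** The series starts at [L], not at [S]: it records the action of [ad S] on all of [L]. *)
Definition lcs S n : {vspace L} := iter n (lieprod S) fullv.

Lemma lcs_stable T S n : lie_stable T S -> lie_stable T (lcs S n).
Proof.
move=> TS; elim: n => [|n IHn] z x zT; first by rewrite !memvf.
move: x; apply: lieprod_ind => [|a x y xW yW|x y xW yW].
- by rewrite raddf0 mem0v.
- by rewrite raddfD /= linearZ /= rpredD // memvZ.
- by rewrite lieA rpredD ?memv_lieprod ?TS ?IHn.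
Qed.

(* Engel's theorem: [M] is built up one dimension at a time, the second clause
   (a vector of [U] outside [W] that [M] sends into [W]) being applied to
   [M] acting on [S] to find an element normalizing [M]. *)
Lemma engel_subalgebra S n : lie_stable S S ->
  (forall x, x \in S -> ad_nilpotent x) -> (n <= \dim S)%N ->
  exists M : {vspace L}, [/\ (M <= S)%VS, \dim M = n, lie_stable M M &
    forall W U, ~~ (U <= W)%VS -> lie_stable M W -> lie_stable M U ->
      exists v, [/\ v \in U, v \notin W & forall m, m \in M -> lie m v \in W]].
Proof.
move=> SS nilS; elim: n => [|n IHn] nS.
  exists 0%VS; split; rewrite ?sub0v ?dimv0 //.
    by move=> x y; rewrite memv0 => /eqP->; rewrite lie0l mem0v.
  move=> W U /subvPn[v vU vW] _ _; exists v; split=> // m.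
  by rewrite memv0 => /eqP->; rewrite lie0l mem0v.
have [M [MS dM MM EM]] := IHn (ltnW nS).
have [||y [yS yM My]] := EM M S _ MM.
- by apply: contraL nS => /dimvS; rewrite dM -leqNgt.
- by move=> x z /(subvP MS); apply: SS.
have memM' z : z \in (M + <[y]>)%VS ->
    exists2 m, m \in M & exists a, z = m + a *: y.
  by case/memv_addP=> m mM [? /vlineP[a ->] ->]; exists m => //; exists a.
exists (M + <[y]>)%VS; split.
- by rewrite subv_add MS -memvE.
- by rewrite dim_addv_line ?dM.
- move=> _ _ /memM'[m mM [a ->]] /memM'[p pM [b ->]].
  apply: (subvP (addvSl M <[y]>)); rewrite lieDl !raddfD /= !linearZ /= !lieZl.
  rewrite lie_alternating !scaler0 addr0 !rpredD ?memvZ ?My //; first exact: MM.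
  by rewrite lieC rpredN My.
move=> W U UW M'W M'U.
have MM' : (M <= M + <[y]>)%VS := addvSl _ _.
have yM' : y \in (M + <[y]>)%VS by rewrite memvE addvSr.
have [||v [vU vW Mv]] := EM W U UW.
- by move=> x z /(subvP MM'); apply: M'W.
- by move=> x z /(subvP MM'); apply: M'U.
have [N yN] := nilS y yS.
(* [ad y] preserves [good] because [[m, y]] lies in [M]; as [ad y] is nilpotent, the last iterate of
   [v] outside [W] is sent into [W] by [y] as well as by [M]. *)
pose good v := v \in U /\ forall m, m \in M -> lie m v \in W.
have good_y u : good u -> good (lie y u).
  case=> uU Mu; split=> [|m mM]; first exact: M'U.
  by rewrite lieA rpredD ?Mu ?My // M'W ?Mu.
have : exists i, iter i (lie y) v \in W by exists N; rewrite yN mem0v.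
case/ex_minnP => [[|i]]; first by rewrite /= (negPf vW).
move=> iW imin; exists (iter i (lie y) v).
have [iU Mi] : good (iter i (lie y) v).
  by elim: (i) => [|j IHj] //; exact: good_y.
split=> // [|_ /memM'[m mM [a ->]]].
  by apply: contraTN isT => /imin; rewrite ltnn.
by rewrite lieDl lieZl rpredD ?memvZ //; exact: Mi.
Qed.

(** For [n = \dim S] the subalgebra [M] is [S] itself. Its second clause with [U = fullv] builds a
    flag from 0 to [L] in which [S] sends each term into the preceding one. *)
Lemma engel S : lie_stable S S -> (forall x, x \in S -> ad_nilpotent x) ->
  exists n, lcs S n = 0%VS.
Proof.
move=> SS nilS.
have [M [MS dM _ EM]] := engel_subalgebra SS nilS (leqnn _).
have {MS dM} defM : M = S by apply/eqP; rewrite eqEdim MS dM /=.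
rewrite {M}defM in EM.
suff chain n : (n <= \dim {:L})%N -> exists W, [/\ \dim W = n, lie_stable S W &
    exists m, forall i, (lcs S i <= W)%VS -> lcs S (i + m) = 0%VS].
  have [W [dW _ [m Wm]]] := chain _ (leqnn _).
  exists (0 + m)%N; apply: Wm.
  by rewrite (eqP (_ : W == fullv)) ?subvf // eqEdim subvf dW /=.
elim: n => [|n IHn] nL.
  exists 0%VS; split; first by rewrite dimv0.
    by move=> x y _; rewrite memv0 => /eqP->; rewrite raddf0 mem0v.
  by exists 0%N => i; rewrite addn0 subv0 => /eqP.
have [W [dW SW [m Wm]]] := IHn (ltnW nL).
have [|//||v [_ vW Sv]] := EM W fullv.
- by apply: contraL nL => /dimvS; rewrite dW -leqNgt.
- by move=> *; rewrite memvf.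
have SW' x y : x \in S -> y \in (W + <[v]>)%VS -> lie x y \in W.
  move=> xS /memv_addP[w wW [? /vlineP[a ->] ->]].
  by rewrite raddfD /= linearZ /= rpredD ?memvZ ?Sv ?SW.
exists (W + <[v]>)%VS; split; first by rewrite dim_addv_line ?dW.
  by move=> x y xS yW; rewrite (subvP (addvSl W <[v]>)) ?SW'.
exists m.+1 => i iW; rewrite addnS -addSn; apply: Wm.
by apply: lieprod_subP => x y xS /(subvP iW); apply: SW'.
Qed.

Lemma derv_lcs n : (derv n.+1 <= lcs (derv 1) n)%VS.
Proof.
elim: n => [|n IHn]; first exact: subvf.
apply: lieprod_subP => x y xD yD; apply: memv_lieprod (subvP IHn _ yD).
exact: subvP (derv_sub 1 n) _ xD.
Qed.

Lemma solvable_ad_nilpotent :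
  (forall x, x \in derv 1 -> ad_nilpotent x) -> lie_solvable L.
Proof.
move=> nil1; have [|n n0] := @engel (derv 1) _ nil1.
  by move=> x y _; apply: derv_ideal; rewrite memvf.
by apply/solvable_derv; exists n.+1; apply/eqP; rewrite -subv0 -n0 derv_lcs.
Qed.

End Subspaces.

(** * Derived algebra of a solvable Lie algebra *)

Section AdjointTraces.
Variables (k : fieldType) (L : fdLieAlgType k).
Implicit Types (x y z : L) (U V W S : {vspace L}) (s : seq L).
Import VectorInternalTheory.

(** Matrices act on row vectors from the right, so products appear reversed, as in [adm_lie]. *)
Definition adm x : 'M[k]_(dim L) := lin1_mx (v2r \o lie x \o r2v).

Lemma v2r_lie x y : v2r (lie x y) = v2r y *m adm x.
Proof. by rewrite mul_rV_lin1 /= v2rK. Qed.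

Lemma v2r_iter n x y : v2r (iter n (lie x) y) = v2r y *m adm x ^+ n.
Proof.
elim: n => [|n IHn]; first by rewrite mulmx1.
by rewrite iterS v2r_lie IHn exprSr -mulmxE mulmxA.
Qed.

Lemma eq_mx_v2r n (A B : 'M[k]_(dim L, n)) :
  (forall y, v2r y *m A = v2r y *m B) -> A = B.
Proof.
move=> eqAB; apply/row_matrixP => i.
by rewrite !rowE -[delta_mx _ _]r2vK.
Qed.

Lemma admP a x y : adm (a *: x + y) = a *: adm x + adm y.
Proof.
apply: eq_mx_v2r => z; rewrite mulmxDr -scalemxAr -!v2r_lie.
by rewrite lieDl lieZl linearP.
Qed.

Lemma adm0 : adm 0 = 0.
Proof. by apply: eq_mx_v2r => z; rewrite -v2r_lie lie0l linear0 mulmx0. Qed.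

Lemma adm_lie x y : adm (lie x y) = adm y * adm x - adm x * adm y.
Proof.
apply: eq_mx_v2r => z; rewrite mulmxBr -mulmxE !mulmxA -!v2r_lie -raddfB /=.
by rewrite (lieA x) addrK.
Qed.

Lemma ad_nilpotentP x : ad_nilpotent x <-> exists n, adm x ^+ n = 0.
Proof.
split=> -[n xn]; exists n.
  by apply: eq_mx_v2r => y; rewrite -v2r_iter xn linear0 mulmx0.
by move=> y; apply: v2r_inj; rewrite v2r_iter xn mulmx0 linear0.
Qed.

Definition ad_word s := \prod_(z <- s) adm z.

(** Words span the unital associative algebra generated by [ad L], so this is membership of [ad x]
    in the radical of its trace form. *)
Definition trace_null x := forall s, \tr (adm x * ad_word s) = 0.

(* By Engel's theorem [(ad b \o w)^N] maps [L] into [lcs S N = 0] for [N] large,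
   whatever the product [w] of adjoint maps. *)
Lemma nil_ideal_trace_null S : lie_stable fullv S ->
  (forall x, x \in S -> ad_nilpotent x) -> forall b, b \in S -> trace_null b.
Proof.
move=> idS nilS b bS s.
have [|N lcsN] := @engel _ _ S _ nilS.
  by move=> x y _; apply: idS; exact: memvf.
have word_stable i y : y \in lcs S i -> r2v (v2r y *m ad_word s) \in lcs S i.
  rewrite /ad_word; elim: s y => [|z s IHs] y yi.
    by rewrite big_nil mulmx1 v2rK.
  rewrite big_cons -mulmxE mulmxA -v2r_lie; apply: IHs.
  exact: (lcs_stable idS (memvf z) yi).
apply: (mxtrace_nilpotent (m := N)).
apply: eq_mx_v2r => y; rewrite mulmx0; apply: r2v_inj; rewrite linear0.
apply/eqP; rewrite -memv0 -lcsN; elim: N {lcsN} => [|N IHN]; first exact: memvf.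
move: IHN; rewrite exprSr [v2r y *m (_ * _)]mulmxA.
move: (v2r y *m _) => v vN; rewrite mulmxA -[v]r2vK -v2r_lie.
by apply: (word_stable N.+1); apply: memv_lieprod.
Qed.

Lemma tr_mulC n (A B : 'M[k]_n) : \tr (A * B) = \tr (B * A).
Proof. exact: mxtrace_mulC. Qed.

(** Up to sign the trace is that of [ad x] times the commutator of [ad y] with [(ad b)^n], which
    expands into terms [(ad b)^i (ad [y, b]) (ad b)^j]. *)
Lemma trace_bracket x y b n : trace_null (lie y b) ->
  \tr (adm (lie x y) * adm b ^+ n) = 0.
Proof.
move=> yb0.
(* The word [s] is arbitrary so that the induction can absorb a factor [adm b] into it. *)
have commute m s :
    \tr (ad_word s * (adm b ^+ m * adm y - adm y * adm b ^+ m)) = 0.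
  elim: m s => [|m IHm] s.
    by rewrite !expr0 mul1r mulr1 subrr mulr0 mxtrace0.
  have -> : adm b ^+ m.+1 * adm y - adm y * adm b ^+ m.+1 =
      adm b * (adm b ^+ m * adm y - adm y * adm b ^+ m)
      + adm (lie y b) * adm b ^+ m.
    by rewrite adm_lie mulrBr mulrBl exprS !mulrA addrA subrK.
  rewrite mulrDr mxtraceD.
  have := IHm (rcons s b); rewrite /ad_word big_rcons /= => IH.
  have := yb0 (nseq m b ++ s); rewrite /ad_word big_cat big_nseq /=.
  rewrite iter_mulr mulr1 => yb.
  by rewrite mulrA IH add0r tr_mulC -mulrA yb.
have := commute n [:: x]; rewrite /ad_word big_seq1 mulrBr raddfB /= => comm.
rewrite adm_lie mulrBl raddfB /= -mulrA tr_mulC.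
by rewrite -mulrA -[adm x * adm y * _]mulrA.
Qed.

Lemma bracket_ad_nilpotent U V b : [pchar k] =i pred0 -> b \in lieprod U V ->
  (forall y, y \in V -> trace_null (lie y b)) -> ad_nilpotent b.
Proof.
move=> char0 bUV Vb; apply/ad_nilpotentP/(nilpotent_of_traces char0) => i.
(* Only the first factor of [b * b^i] is expanded into brackets; [b] stays fixed in the power. *)
rewrite exprS; move: {1 2}b bUV; apply: lieprod_ind => [|a x y x0 y0|x y _ yV].
- by rewrite adm0 mul0r mxtrace0.
- by rewrite admP mulrDl mxtraceD y0 addr0 -mulmxE -scalemxAl mxtraceZ x0 mulr0.
- exact/trace_bracket/Vb.
Qed.

Lemma ad_nilpotent0 : ad_nilpotent (0 : L).
Proof. by exists 1%N => y; rewrite /= lie0l. Qed.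

Lemma derv1_ad_nilpotent x : [pchar k] =i pred0 -> lie_solvable L ->
  x \in derv L 1 -> ad_nilpotent x.
Proof.
move=> char0 /solvable_derv[n Dn].
suff nil j m : derv L (m.+1 + j) = 0%VS ->
    forall y, y \in derv L m.+1 -> ad_nilpotent y.
  apply: (nil n 0%N); apply/eqP; rewrite -subv0 -Dn addnC; exact: derv_sub.
elim: j m => [|j IHj] m Dj.
  move=> y; rewrite -[m.+1]addn0 Dj memv0 => /eqP->; exact: ad_nilpotent0.
have nilD2 : forall y, y \in derv L m.+2 -> ad_nilpotent y.
  by apply: IHj; rewrite addSnnS.
have null2 := nil_ideal_trace_null (@derv_ideal _ _ m.+2) nilD2.
(* One step up the derived series passes through [P]: bracketing [derv L m.+1] with [P] lands in
   [derv L m.+2], so [P] is ad-nilpotent; bracketing [L] with [derv L m.+1] lands in [P], so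
   [derv L m.+1] is too. *)
pose P : {vspace L} := lieprod fullv (derv L m.+1).
have PD : (P <= derv L m.+1)%VS by apply: lieprod_subP; exact: derv_ideal.
have idP : lie_stable fullv P.
  by move=> z y _ /(subvP PD) yD; apply: memv_lieprod => //; exact: memvf.
have nilP y : y \in P -> ad_nilpotent y.
  move=> yP; apply: (bracket_ad_nilpotent char0 yP) => z zD.
  by apply: null2; apply: memv_lieprod => //; apply: (subvP PD).
have nullP := nil_ideal_trace_null idP nilP.
move=> y yD.
have yLL : y \in lieprod fullv (fullv : {vspace L}).
  by apply: (subvP (derv_sub L 1 m)); rewrite add1n.
apply: (bracket_ad_nilpotent char0 yLL) => z _; apply: nullP.
by apply: memv_lieprod => //; exact: memvf.
Qed.

End AdjointTraces.

(** * Polynomials in adjoint maps and inverse limits *)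

(** Cayley-Hamilton with the power of [X] split off; [q(A)] is spelled out as a sum to match
    [ad_poly]. *)
Lemma annihilating_split (k : fieldType) n (A : 'M[k]_n) :
  exists m, exists2 q : {poly k}, q.[0] != 0 &
    (\sum_(i < size q) q`_i *: A ^+ i) * A ^+ m = 0.
Proof.
case: n A => [|n] A.
  by exists 0%N, 1; rewrite ?hornerC ?oner_neq0 // [LHS]flatmx0 [RHS]flatmx0.
have [m [q q0 eq_cA]] := poly_split0 (monic_neq0 (char_poly_monic A)).
exists m, q => //.
have <- : horner_mx A q = \sum_(i < size q) q`_i *: A ^+ i.
  rewrite -[q in LHS]coefK poly_def rmorph_sum; apply: eq_bigr => i _ /=.
  by rewrite horner_mxZ rmorphXn /= horner_mx_X.
have := Cayley_Hamilton A; rewrite eq_cA mulrC rmorphM /= rmorphXn /=.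
by rewrite horner_mx_X.
Qed.

Section AdjointPolynomials.
Variable k : fieldType.

(** This is [q(ad x)] applied to [y], without matrices because the limit [A] may be
    infinite-dimensional. *)
Definition ad_poly (L : lieAlgType k) (q : {poly k}) (x y : L) : L :=
  \sum_(i < size q) q`_i *: iter i (lie x) y.

Lemma ad_poly_linear (L : lieAlgType k) q (x : L) : linear (ad_poly q x).
Proof.
move=> a y z; rewrite /ad_poly scaler_sumr -big_split /=; apply: eq_bigr => i _.
rewrite scalerA mulrC -scalerA -scalerDr; congr (_ *: _).
by elim: (i : nat) => //= j ->; rewrite linearP.
Qed.

HB.instance Definition _ (L : lieAlgType k) q (x : L) :=
  GRing.isLinear.Build k L L *:%R (ad_poly q x) (ad_poly_linear q x).

(** Only intertwining of [ad x] and [ad x'] is asked of [f], which covers Lie morphisms and also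
    [f = lie x]. *)
Lemma ad_poly_morph (L M : lieAlgType k) (f : {linear L -> M}) q x x' y :
  (forall z, f (lie x z) = lie x' (f z)) ->
  f (ad_poly q x y) = ad_poly q x' (f y).
Proof.
move=> fx; rewrite raddf_sum; apply: eq_bigr => i _; rewrite /= linearZ /=.
by congr (_ *: _); elim: (i : nat) => //= j <-.
Qed.

(** Induction on the power of [ad x] killing [y]: [[x, y]] is also in the kernel, hence 0, and then
    [q(ad x) y = q(0) y]. *)
Lemma ad_poly_eq0 (L : lieAlgType k) q (x y : L) : ad_nilpotent x ->
  q.[0] != 0 -> ad_poly q x y = 0 -> y = 0.
Proof.
case=> n /(_ y); elim: n y => [|n IHn] y //; rewrite iterSr => yn q0 qy.
have xy0 : lie x y = 0.
  apply: IHn => //.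
  by rewrite -(ad_poly_morph (f := lie x) (x := x) q y) // qy raddf0.
have : (0 < size q)%N.
  by rewrite size_poly_gt0; apply: contraNneq q0 => ->; rewrite horner0.
move: qy; rewrite /ad_poly; case: (size q) => // s.
rewrite big_ord_recl big1 ?addr0 => [/eqP + _|i _].
  by rewrite scaler_eq0 -horner_coef0 (negPf q0) => /eqP.
rewrite lift0 iterSr xy0.
suff -> : iter i (lie x) 0 = 0 by rewrite scaler0.
by elim: (i : nat) => //= j ->; rewrite raddf0.
Qed.

End AdjointPolynomials.

Lemma ad_poly_limit_surjective (k : fieldType) (d : Order.disp_t)
    (I : porderType d) (L : I -> fdLieAlgType k)
    (phi : forall i j : I, (i <= j)%O -> {linear L i -> L j})
    (phi_system : is_inverse_system (L := fun i => L i) phi)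
    (A : lieAlgType k) (pi : forall i : I, {linear A -> L i})
    (A_limit : is_inverse_limit (L := fun i => L i) phi pi) (x : A) q :
  (forall i, ad_nilpotent (pi i x)) -> q.[0] != 0 ->
  forall b, exists a, ad_poly q x a = b.
Proof.
move=> nilx q0 b; case: phi_system => phi_lie _ _.
case: A_limit => pi_lie pi_phi pi_inj pi_surj.
pose g i := linfun (ad_poly q (pi i x)).
have gE i y : g i y = ad_poly q (pi i x) y by rewrite lfunE.
have g_inj i : injective (g i).
  move=> y z /eqP; rewrite -subr_eq0 -raddfB /= gE => /eqP.
  by move=> /(ad_poly_eq0 (nilx i) q0) /subr0_eq.
(* An injective endomorphism of a finite-dimensional space is surjective. *)
have gK i y : ad_poly q (pi i x) (((g i)^-1)%VF y) = y.
  by rewrite -gE; apply: lker0_lfunVK; apply/lker0P; apply: g_inj.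
have [|a pia] := pi_surj (fun i => ((g i)^-1)%VF (pi i b)).
  (* Compatibility of the preimages is tested after applying the injective [g j], which the
     connecting maps intertwine with [g i]. *)
  move=> i j ij; apply: (g_inj j); rewrite !gE gK.
  rewrite -(ad_poly_morph (f := phi i j ij) (x := pi i x) q) ?gK ?pi_phi //.
  by move=> z; rewrite phi_lie pi_phi.
exists a; apply: pi_inj => i.
rewrite (ad_poly_morph (f := pi i) (x' := pi i x) q) ?pia ?gK // => z.
exact: pi_lie.
Qed.

Section FiniteDimensionalImage.
Variables (k : fieldType) (A : lieAlgType k) (B : fdLieAlgType k).
Variables (f : {linear A -> B}).
Hypotheses (f_morphism : lie_morphism f)
  (f_surjective : forall b : B, exists a : A, f a = b).
Import VectorInternalTheory.

Lemma image_ad_nilpotent x :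
  (forall q b, q.[0] != 0 -> exists a, ad_poly q x a = b) -> ad_nilpotent (f x).
Proof.
move=> surj_x; have [m [q q0 qm0]] := annihilating_split (adm (f x)).
(* Every [y] is [q(ad (f x)) (f a)] for some [a], and [(ad (f x))^m] kills such elements. *)
exists m => y; have [a0 <-] := f_surjective y; have [a <-] := surj_x q a0 q0.
rewrite (ad_poly_morph (f := f) (x' := f x) q); last first.
  by move=> z; rewrite f_morphism.
apply: v2r_inj; rewrite v2r_iter linear0 /ad_poly raddf_sum /=.
rewrite -[RHS](mulmx0 _ (v2r (f a))) -qm0 -mulmxE mulmxA; congr (_ *m _).
rewrite mulmx_sumr; apply: eq_bigr => i _.
by rewrite linearZ /= v2r_iter scalemxAr.
Qed.

End FiniteDimensionalImage.

Theorem corollary20 (k : fieldType) (char0 : [pchar k] =i pred0)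
    (d : Order.disp_t) (I : porderType d) (I_directed : inversely_directed I)
    (L : I -> fdLieAlgType k) (L_solvable : forall i : I, lie_solvable (L i))
    (phi : forall i j : I, (i <= j)%O -> {linear L i -> L j})
    (phi_system : is_inverse_system (L := fun i => L i) phi)
    (A : lieAlgType k) (pi : forall i : I, {linear A -> L i})
    (A_limit : is_inverse_limit (L := fun i => L i) phi pi)
    (B : fdLieAlgType k) (f : {linear A -> B}) (f_morphism : lie_morphism f)
    (f_surjective : forall b : B, exists a : A, f a = b) :
  lie_solvable B.
Proof.
apply: solvable_ad_nilpotent => y yB.
(* A combination of brackets in [B] lifts to one in [A]. Only its components are recorded, as
   [lieprod] is limited to finite dimension. *)
have [x fx pix] : exists2 x, f x = y & forall i, pi i x \in derv (L i) 1.
  move: y yB; apply: lieprod_ind => [|c _ _ [x1 <- x1D] [x2 <- x2D]|y z _ _].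
  - by exists 0 => [|i]; rewrite raddf0 ?mem0v.
  - exists (c *: x1 + x2) => [|i]; first by rewrite linearP.
    by rewrite linearP rpredD ?memvZ ?x1D ?x2D.
  - have [[u <-] [v <-]] := (f_surjective y, f_surjective z).
    exists (lie u v) => [|i]; first by rewrite f_morphism.
    by case: A_limit => pi_lie _ _ _; rewrite pi_lie memv_lieprod ?memvf.
rewrite -fx; apply: (image_ad_nilpotent f_morphism f_surjective) => q b q0.
apply: (ad_poly_limit_surjective phi_system A_limit) q0 b => i.
exact: derv1_ad_nilpotent char0 (L_solvable i) (pix i).
Qed.
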